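(* For every $\varepsilon>0$ there exists some $\delta>0$ such that if a bipartite graph $F$ satisfies $\mathrm{ex}(m,F)=\Omega(m^{2-\delta})$ as $m\to\infty$, then $f_{F,K_4}(n)=\Omega(n^{1/2-\varepsilon})$ as $n\to\infty$.
   Context: All graphs are finite and simple. A graph is $F$-free if it does not contain $F$ as a (not necessarily induced) subgraph. For graphs $F,H$ and a positive integer $n$, $f_{F,H}(n)$ denotes the largest $m$ such that every $H$-free graph on $n$ vertices contains an $F$-free induced subgraph on $m$ vertices. $\mathrm{ex}(m,F)$ is the Turán number: the maximum number of edges in an $F$-free graph on $m$ vertices. The constants implied by $\Omega(\cdot)$ are positive and may depend on $F$ and $\varepsilon$ (and $\delta$), but not on $m$ or $n$. *)

(* Defs.v *)
From HB Require Import structures.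
From mathcomp Require Import all_boot all_order all_algebra.
From mathcomp Require Import all_classical all_reals all_analysis.

Set Implicit Arguments.
Unset Strict Implicit.
Unset Printing Implicit Defensive.

Record sgraph := SGraph {
  vertex :> finType;
  adj : rel vertex;
  adj_sym : symmetric adj;
  adj_irr : irreflexive adj }.

Definition num_edges (G : sgraph) : nat :=
  #|[set e : {set G} | [exists x, exists y, adj x y && (e == [set x; y])%SET]]%SET|.

Definition contains (G F : sgraph) : Prop :=
  exists f : F -> G, injective f /\ forall x y, adj x y -> adj (f x) (f y).

Definition is_free (F G : sgraph) : Prop := ~ contains G F.

Definition bipartite (F : sgraph) : Prop :=
  exists A : {set F}, forall x y : F, adj x y -> (x \in A) != (y \in A).

Section Induced.
Variables (G : sgraph) (S : {set G}).
Let ind_adj : rel {x : G | x \in S} := fun x y => adj (val x) (val y).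
Let ind_sym : symmetric ind_adj. Proof. by move=> x y; exact: adj_sym. Qed.
Let ind_irr : irreflexive ind_adj. Proof. by move=> x; exact: adj_irr. Qed.
Definition induced : sgraph := SGraph ind_sym ind_irr.
End Induced.

Section Complete.
Variable n : nat.
Let c_adj : rel 'I_n := fun x y => x != y.
Let c_sym : symmetric c_adj.
Proof. by move=> x y; rewrite /c_adj eq_sym. Qed.
Let c_irr : irreflexive c_adj. Proof. by move=> x; rewrite /c_adj eqxx. Qed.
Definition complete : sgraph := SGraph c_sym c_irr.
End Complete.

(* The index bound 'C(m, 2) is harmless: a graph on m vertices has no more
   edges.  The maximum is 0 if no graph on m vertices is F-free, which happens
   only if F has no edges. *)
Definition turan (m : nat) (F : sgraph) : nat :=
  \max_(k < 'C(m, 2).+1 |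
        `[< exists G : sgraph, #|G| = m /\ is_free F G /\ num_edges G = k >]) k.

(* The largest m such that every H-free graph on n vertices has an F-free
   induced subgraph on m vertices.  Such an m is at most n as long as some graph
   on n vertices is H-free (true if H has an edge), and m = 0 qualifies as long
   as F has a vertex. *)
Definition fFH (F H : sgraph) (n : nat) : nat :=
  \max_(m < n.+1 |
        `[< forall G : sgraph, #|G| = n -> is_free H G ->
              exists S : {set G}, #|S| = m /\ is_free F (induced S) >]) m.

(* Main.v *)
(** Let [G] be a [K_4]-free graph on [n] vertices without independent sets of
    size [q], where [q] is about [n^(1/2 - 1/w)] and [w] is a large constant.
    Common neighbourhoods of edges of [G] are independent, so dependent random
    choice shows that, for every vertex set [C] of size at least [n^(1/2)], fewer
    than about [n^(1/2 + 1/w)] vertices are adjacent to a fraction [n^(-c)] of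
    [C]. In a random set of [q] vertices, any [M] vertices, with [M] a large
    constant, therefore have fewer than [n^(1/2)] common neighbours, so that a
    given sampled vertex is among them with probability less than [n^(-1/2)].
    If a subgraph of [F] has large minimum degree, a greedy choice yields a small
    set [R] and a much larger set [Y] of vertices of [F] with at least [M]
    neighbours in [R] each. There are at most [q ^ #|R|] copies of [R] in the
    sample, and each vertex of [Y] then contributes a factor
    [q * n^(-1/2) = n^(-1/w)]; so a random [q]-set contains no copy of [R] and
    [Y], hence none of [F].

    If no subgraph of [F] has minimum degree [t], then [F] can be embedded
    vertex by vertex into any pair [U1], [U2] of vertex sets such that any [t]
    vertices of one set have [#|F|] common neighbours in the other one. As shown
    by Alon, Krivelevich and Sudakov, dependent random choice provides such a
    pair in every large graph with at least [m^(2 - delta)] edges, where [delta]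
    depends on [t] only; so [ex(m, F)] is too small.

    Sizes are measured in powers of a base [B] with
    [B ^ (2 * w ^ 2) <= n <= (2 * B) ^ (2 * w ^ 2)]; so [n^(1/2)] becomes
    [B ^ (w ^ 2)], and [q] is [B ^ (w ^ 2 - 2 * w - 1)]. *)
Require Import Defs.
From mathcomp Require Import all_boot all_order all_algebra.
From mathcomp Require Import all_classical all_reals all_analysis.
From mathcomp Require Import zify ring lra.
Import Order.TTheory GRing.Theory Num.Theory.
Import numFieldNormedType.Exports.

Set Implicit Arguments.
Unset Strict Implicit.
Unset Printing Implicit Defensive.

(** * Counting tuples: dependent random choice, rich tuples, random samples *)

Section FiniteRelations.
Local Open Scope nat_scope.
Local Open Scope set_scope.

Lemma leq_expn2r k m n : m <= n -> m ^ k <= n ^ k.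
Proof. by case: k => // k; rewrite leq_exp2r. Qed.

Lemma card_le_sum_cover (T I : finType) (A : {pred T}) (P : {pred I})
    (B : I -> {pred T}) :
  (forall x, x \in A -> exists2 i, P i & x \in B i) -> #|A| <= \sum_(i | P i) #|B i|.
Proof.
move=> cover; under eq_bigr do rewrite -sum1_card.
rewrite (exchange_big_dep predT) //= -sum1_card big_mkcond /=.
apply: leq_sum => x _; case: ifP => // /cover[i Pi xB].
by rewrite (bigD1 i) //= Pi xB.
Qed.

Variables (T : finType) (e : rel T).

Definition common_nbhd (J : finType) (C : {set T}) (h : J -> T) : {set T} :=
  [set c in C | [forall j, e (h j) c]].

Lemma eq_common_nbhd (J : finType) (C : {set T}) (h h' : J -> T) :
  h =1 h' -> common_nbhd C h = common_nbhd C h'.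
Proof.
by move=> hh'; apply/setP => c; rewrite !inE; under eq_forallb do rewrite hh'.
Qed.

(** Double counting bounds the sum of [#|common_nbhd X g|] over all [g] with values in [C] from
    below by [#|X| * (#|C| / beta) ^ #|K|]. Each term is at most [z] plus [#|X|] for every bad [h]
    inside that neighbourhood, and a given [h] lies there only for the at most [b ^ #|K|] tuples [g]
    with values in [common_nbhd C h]. *)
Lemma dependent_random_choice (J K : finType) (X C : {set T})
    (Bad : {set {ffun J -> T}}) (beta z b : nat) :
  symmetric e ->
  (forall x, x \in X -> #|C| <= beta * #|[set c in C | e x c]|) ->
  (forall h, h \in Bad -> #|common_nbhd C h| <= b) ->
  (forall g : {ffun K -> T}, (forall i, g i \in C) ->
     (forall h, h \in Bad -> ~~ [forall j, h j \in common_nbhd X g]) ->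
     #|common_nbhd X g| <= z) ->
  #|X| * #|C| ^ #|K| <=
    beta ^ #|K| * (z * #|C| ^ #|K| + #|X| * (#|Bad| * b ^ #|K|)).
Proof.
move=> esym degX badC goodU.
pose hit (g : {ffun K -> T}) (h : {ffun J -> T}) :=
  [forall j, h j \in common_nbhd X g].
have double : \sum_(g in ffun_on (mem C)) #|common_nbhd X (fun i : K => g i)| =
    \sum_(x in X) #|[set c in C | e x c]| ^ #|K|.
  under eq_bigr do rewrite -sum1_card.
  rewrite (exchange_big_dep (mem X)) /=; last by move=> g x _; rewrite inE => /andP[].
  apply: eq_bigr => x xX; rewrite -card_ffun_on -sum1_card; apply: eq_bigl => g.
  rewrite !inE xX /=; apply/andP/ffun_onP => [[/ffun_onP gC /forallP eg] i|gN].
    by rewrite inE (gC i) esym eg.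
  split; first by apply/ffun_onP => i; have := gN i; rewrite inE => /andP[].
  by apply/forallP => i; have := gN i; rewrite inE esym => /andP[].
have lower : #|X| * #|C| ^ #|K| <=
    beta ^ #|K| * \sum_(x in X) #|[set c in C | e x c]| ^ #|K|.
  rewrite -sum_nat_const big_distrr; apply: leq_sum => x xX /=.
  by rewrite -expnMn leq_expn2r ?degX.
apply: leq_trans lower _; rewrite leq_mul2l -double; apply/orP; right.
have pointwise (g : {ffun K -> T}) : g \in ffun_on (mem C) ->
    #|common_nbhd X g| <= z + \sum_(h in Bad) #|X| * hit g h.
  move=> /ffun_onP gC; have [goodg|] := boolP [forall h in Bad, ~~ hit g h].
    apply: leq_trans (leq_addr _ _); apply: goodU => // h hB.
    by move/forall_inP: goodg => /(_ h hB).
  rewrite negb_forall_in => /exists_inP[h hB]; rewrite negbK => hitgh.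
  rewrite (bigD1 h) //= hitgh muln1 addnCA; apply: leq_trans (leq_addr _ _).
  by apply/subset_leq_card/fintype.subsetP => x; rewrite inE => /andP[].
apply: (@leq_trans (\sum_(g in ffun_on (mem C)) (z + \sum_(h in Bad) #|X| * hit g h)));
  first exact: leq_sum.
rewrite big_split /= sum_nat_const card_ffun_on mulnC leq_add2l.
rewrite exchange_big /= [leqRHS]mulnCA -[leqRHS]sum_nat_const; apply: leq_sum => h hB.
rewrite -big_distrr leq_mul2l; apply/orP; right.
apply: leq_trans (leq_expn2r #|K| (badC h hB)).
rewrite -card_ffun_on -sum1_card big_mkcond [leqRHS]big_mkcond /=.
apply: leq_sum => g _; case: ifP => // /ffun_onP gC.
case: ifP => [|/negP ngC]; first by case: (hit g h).
rewrite /hit; case: forallP => // hitg; case: ngC; apply/ffun_onP => i.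
rewrite inE gC; apply/forallP => j.
by have := hitg j; rewrite inE esym => /andP[_ /forallP].
Qed.

Lemma card_ffun_ordS i (A : {set {ffun 'I_i.+1 -> T}}) (B : T -> {set {ffun 'I_i -> T}}) :
  (forall h, h \in A -> [ffun j => h (lift ord0 j)] \in B (h ord0)) ->
  #|A| <= \sum_x #|B x|.
Proof.
move=> AB; rewrite -sum1_card (partition_big (fun h : {ffun 'I_i.+1 -> T} => h ord0) predT) //=.
apply: leq_sum => x _; rewrite sum1_card.
pose tl (h : {ffun 'I_i.+1 -> T}) := [ffun j : 'I_i => h (lift ord0 j)].
have tlI : {in [pred h | (h \in A) && (h ord0 == x)] &, injective tl}.
  move=> h h' /andP[_ /eqP h0] /andP[_ /eqP h0'] /ffunP hh'; apply/ffunP => j.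
  by case: (unliftP ord0 j) => [k ->|->]; [have := hh' k; rewrite !ffunE | rewrite h0 h0'].
rewrite -(card_in_imset tlI); apply/subset_leq_card/fintype.subsetP => g /imsetP[h].
by rewrite inE => /andP[hA /eqP <-] ->; apply: AB.
Qed.

(* Along a rich tuple the common neighbourhood can shrink by the factor [B]
   only [d] times, so all but [d] entries lie in a set of size [#|T| / D]. *)
Lemma card_rich_tuples (P B D : nat) :
  (forall C : {set T}, P <= #|C| ->
     #|[set x | #|C| <= B * #|[set c in C | e x c]|]| * D <= #|T|) ->
  0 < B -> 0 < D -> forall i d (C : {set T}), #|C| < P * B ^ d ->
  #|[set h : {ffun 'I_i -> T} | P <= #|common_nbhd C h|]| * D ^ i <=
    2 ^ i * #|T| ^ i * D ^ d.
Proof.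
move=> few B0 D0.
elim=> [|i IH] d C ltC.
  rewrite !expn0 !muln1 mul1n; apply: (@leq_trans 1); last by rewrite expn_gt0 D0.
  by apply: leq_trans (max_card _) _; rewrite card_ffun card_ord.
pose N x := [set c in C | e x c].
pose rich k (C' : {set T}) := [set h : {ffun 'I_k -> T} | P <= #|common_nbhd C' h|].
have [ltCP|leCP] := ltnP #|C| P.
  suff -> : [set h : {ffun 'I_i.+1 -> T} | P <= #|common_nbhd C h|] = finset.set0.
    by rewrite cards0.
  apply/setP => h; rewrite !inE leqNgt (leq_ltn_trans _ ltCP) //.
  by apply/subset_leq_card/fintype.subsetP => x; rewrite inE => /andP[].
case: d ltC => [|d] ltC; first by move: ltC; rewrite muln1 ltnNge leCP.
pose X := [set x | #|C| <= B * #|N x|].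
have split_first : #|rich i.+1 C| <= \sum_x #|rich i (N x)|.
  apply: card_ffun_ordS => h; rewrite !inE => /leq_trans; apply.
  apply/subset_leq_card/fintype.subsetP => c; rewrite !inE => /andP[-> /forallP eh].
  by rewrite eh; apply/forallP => j; rewrite ffunE.
apply: (@leq_trans (\sum_x #|rich i (N x)| * D ^ i.+1)).
  by rewrite -big_distrl leq_mul2r split_first orbT.
have inX x : #|rich i (N x)| * D ^ i <= 2 ^ i * #|T| ^ i * D ^ d.+1.
  apply: IH; apply: leq_ltn_trans ltC; apply/subset_leq_card/fintype.subsetP => c.
  by rewrite inE => /andP[].
have outX x : x \notin X -> #|rich i (N x)| * D ^ i <= 2 ^ i * #|T| ^ i * D ^ d.
  rewrite inE -ltnNge => ltNC; apply: IH; rewrite -(ltn_pmul2l B0).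
  by apply: leq_trans ltNC _; rewrite mulnCA -expnS ltnW.
(* A first entry in [X] keeps the exponent [d.+1] but has at most [#|T| / D] values; one outside [X]
   has up to [#|T|] values but lowers the exponent by one. Both cases get the same bound, hence the
   factor 2 per entry. *)
rewrite (bigID (mem X)) /=.
apply: (@leq_trans (\sum_(x in X) 2 ^ i * #|T| ^ i * D ^ d.+1 * D +
                    \sum_(x in ~: X) 2 ^ i * #|T| ^ i * D ^ d * D)).
  apply: leq_add; first by apply: leq_sum => x _; rewrite expnSr mulnA leq_mul2r inX orbT.
  rewrite [leqRHS](eq_bigl (fun x => x \notin X)); last by move=> x; rewrite finset.in_setC.
  by apply: leq_sum => x xX; rewrite expnSr mulnA leq_mul2r outX ?orbT.
rewrite !sum_nat_const.
have XT := few C leCP; rewrite -/(N _) -/X in XT.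
have XcT : #|~: X| <= #|T| by apply: max_card.
rewrite !expnS.
set p := 2 ^ i; set q := #|T| ^ i; set r := D ^ d.
have h1 : (#|X| * D) * (p * q * (D * r)) <= #|T| * (p * q * (D * r)).
  by rewrite leq_mul2r XT orbT.
have h2 : #|~: X| * (p * q * r * D) <= #|T| * (p * q * r * D).
  by rewrite leq_mul2r XcT orbT.
move: h1 h2 => /=; move: #|X| #|~: X| #|T| => x y t; lia.
Qed.

(** The event that a random sample of size [q] contains a pattern from [A]. Samples are tuples with
    possible repetitions, so that probabilities are ratios to powers of [#|T|]. *)
Definition meeting (J : finType) q (A : {set {ffun J -> T}}) : {set {ffun 'I_q -> T}} :=
  [set g : {ffun 'I_q -> T} | [exists f : {ffun J -> 'I_q},
     injectiveb f && ([ffun j => g (f j)] \in A)]].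

Lemma card_meeting_at (I J : finType) (A : {set {ffun J -> T}}) (f : {ffun J -> I}) :
  injective f ->
  #|[set g : {ffun I -> T} | [ffun j => g (f j)] \in A]| * #|T| ^ #|J| <=
    #|A| * #|T| ^ #|I|.
Proof.
move=> finj; pose sel i := [pick j | f j == i].
have self j : sel (f j) = Some j.
  rewrite /sel; case: pickP => [k /eqP/finj -> //|/(_ j)]; by rewrite eqxx.
have selP i j : sel i = Some j -> f j = i.
  by rewrite /sel; case: pickP => // k /eqP ? [<-].
(* [swap] exchanges the entries of [g] at the positions [f j] with [h]; it maps the event times all
   [h] injectively into [A] times all samples. *)
pose swap (gh : {ffun I -> T} * {ffun J -> T}) : {ffun J -> T} * {ffun I -> T} :=
  ([ffun j => gh.1 (f j)], [ffun i => if sel i is Some j then gh.2 j else gh.1 i]).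
have swapI : injective swap.
  move=> [g h] [g' h'] [/ffunP e1 /ffunP e2].
  congr (_, _); apply/ffunP => i.
    case seli: (sel i) => [j|]; last by have := e2 i; rewrite !ffunE seli.
    by have := e1 j; rewrite !ffunE (selP _ _ seli).
  by have := e2 (f i); rewrite !ffunE self.
rewrite -(card_ffun J T) -(card_ffun I T) -!cardsT -!cardsX -(card_imset _ swapI).
apply/subset_leq_card/fintype.subsetP => x /imsetP[[g h]].
by rewrite !inE /= andbT => gA -> /=; rewrite gA.
Qed.

(** A union bound over the at most [q ^ #|J|] choices of positions. The constant 4 allows three such
    events to be avoided at once. *)
Lemma card_meeting (J : finType) q (A : {set {ffun J -> T}}) : 0 < #|T| ->
  4 * (q ^ #|J| * #|A|) <= #|T| ^ #|J| -> 4 * #|meeting q A| <= #|T| ^ q.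
Proof.
move=> T0 leA; have TJ : 0 < #|T| ^ #|J| by rewrite expn_gt0 T0.
rewrite -(leq_pmul2r TJ).
have union : #|meeting q A| <= \sum_(f : {ffun J -> 'I_q} | injectiveb f)
    #|[set g : {ffun 'I_q -> T} | [ffun j => g (f j)] \in A]|.
  apply: card_le_sum_cover => g; rewrite inE => /existsP[f /andP[fI gA]].
  by exists f; rewrite ?inE.
have each : \sum_(f : {ffun J -> 'I_q} | injectiveb f)
    #|[set g : {ffun 'I_q -> T} | [ffun j => g (f j)] \in A]| * #|T| ^ #|J| <=
    q ^ #|J| * (#|A| * #|T| ^ q).
  apply: (@leq_trans (\sum_(f : {ffun J -> 'I_q}) #|A| * #|T| ^ q)).
    rewrite big_mkcond; apply: leq_sum => f _; case: ifP => // /injectiveP fI.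
    by have := card_meeting_at A fI; rewrite card_ord.
  by rewrite sum_nat_const card_ffun card_ord.
rewrite -big_distrl in each.
have := leq_mul union (leqnn (#|T| ^ #|J|)) => /leq_trans /(_ each) le1.
have := leq_mul leA (leqnn (#|T| ^ q)).
move: le1 => /=; move: #|meeting q A| #|A| (#|T| ^ q) (#|T| ^ #|J|) (q ^ #|J|).
by move=> a b c d f; nia.
Qed.

Lemma card_dependent_pairs (I J : finType) (K : {ffun I -> T} -> J -> {set T}) P :
  (forall h j, #|K h j| <= P) ->
  #|[set f : {ffun I + J -> T} |
     [forall j, f (inr j) \in K [ffun i => f (inl i)] j]]| <=
    #|T| ^ #|I| * P ^ #|J|.
Proof.
move=> KP.
pose r1 (f : {ffun I + J -> T}) := [ffun i => f (inl i)].
pose r2 (f : {ffun I + J -> T}) := [ffun j => f (inr j)].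
rewrite -sum1_card (partition_big r1 predT) //= -card_ffun -sum_nat_const.
apply: leq_sum => h _; rewrite sum1_card.
have r2I : {in [pred f | (f \in [set f : {ffun I + J -> T} |
     [forall j, f (inr j) \in K [ffun i => f (inl i)] j]]) && (r1 f == h)] &,
     injective r2}.
  move=> f f' /andP[_ /eqP e1] /andP[_ /eqP e2] /ffunP e3; apply/ffunP => -[i|j].
    by have := congr1 (fun u : {ffun I -> T} => u i) (etrans e1 (esym e2)); rewrite !ffunE.
  by have := e3 j; rewrite !ffunE.
rewrite -(card_in_imset r2I).
apply: (@leq_trans #|family (K h)|).
  apply/subset_leq_card/fintype.subsetP => g /imsetP[f].
  rewrite !inE => /andP[/forallP fK /eqP <-] ->.
  by apply/familyP => j; rewrite ffunE; apply: fK.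
rewrite card_family [X in P ^ X]cardE /image_mem; elim: (enum _) => //= j s IHs.
by rewrite expnS leq_mul.
Qed.
End FiniteRelations.

(** * Sparse samples in [K_4]-free graphs *)

Section LocallySparseSets.
Local Open Scope nat_scope.
Local Open Scope set_scope.

Lemma meetingN (T J : finType) q (A : {set {ffun J -> T}})
    (g : {ffun 'I_q -> T}) (f : J -> T) :
  g \notin meeting q A -> injective f -> (forall j, f j \in [set g i | i : 'I_q]) ->
  [ffun j => f j] \notin A.
Proof.
move=> gA fI fg; apply: contra gA => fA; rewrite inE; apply/existsP.
have gk j : exists i, g i == f j by have /imsetP[i _ ->] := fg j; exists i.
pose k j := xchoose (gk j); have gkE j : g (k j) = f j by apply/eqP/(xchooseP (gk j)).
exists [ffun j => k j]; apply/andP; split.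
  by apply/injectiveP => i j; rewrite !ffunE => kij; apply: fI; rewrite -!gkE kij.
by rewrite (_ : [ffun j => _] = [ffun j => f j]) //; apply/ffunP => j; rewrite !ffunE gkE.
Qed.

Definition independent (G : sgraph) (I : {set G}) : Prop :=
  forall x y, x \in I -> y \in I -> ~~ adj x y.

Lemma K4_free_codegree (G : sgraph) : is_free (complete 4) G ->
  forall x y : G, adj x y ->
  independent [set z | adj x z && adj y z].
Proof.
move=> K4 x y xy c d; rewrite !inE => /andP[xc yc] /andP[xd yd].
apply/negP => cd; apply: K4.
pose f (i : 'I_4) := nth x [:: x; y; c; d] i.
have fadj i j : i != j -> adj (f i) (f j).
  by case: i j => [[|[|[|[|i]]]] Hi] [[|[|[|[|j]]]] Hj] //= _; rewrite /f //= adj_sym.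
exists f; split=> [i j fij|]; last exact: fadj.
by apply/eqP; apply/negPn/negP => /fadj; rewrite fij adj_irr.
Qed.

(* If [X] were large, the common neighbourhood in [X] of a random tuple from
   [C] would be a large set each of whose edges has many common neighbours in
   [C]; these are pairwise non-adjacent, as there is no [K_4]. *)
Lemma few_rich_vertices (G : sgraph) (w B : nat) (C : {set G}) :
  3 <= w -> 4 <= B -> is_free (complete 4) G ->
  (forall I : {set G}, independent I -> #|I| < B ^ (w * w - 2 * w - 1)) ->
  B ^ (2 * (w * w)) <= #|G| <= (2 * B) ^ (2 * (w * w)) ->
  B ^ (w * w) <= #|C| ->
  #|[set x | #|C| <= B * #|[set c in C | adj x c]|]| * B ^ (w * w - 2 * w) <= #|G|.
Proof.
move=> w3 B4 K4 indG /andP[Gge Gle] Cge; set X := [set x | _].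
set q := B ^ (w * w - 2 * w - 1) in indG.
have ww : 3 * w <= w * w by rewrite leq_mul2r w3 orbT.
pose Bad := [set h : {ffun bool -> G} |
  adj (h true) (h false) && (#|common_nbhd (@adj G) C h| < q)].
have drc : #|X| * #|C| ^ (4 * w) <=
    B ^ (4 * w) * (q * #|C| ^ (4 * w) + #|X| * (#|Bad| * q ^ (4 * w))).
  have := @dependent_random_choice G (@adj G) bool 'I_(4 * w) X C Bad B q q.
  rewrite card_ord; apply; first exact: adj_sym.
  - by move=> x; rewrite inE.
  - by move=> h; rewrite inE => /andP[_ /ltnW].
  - move=> g gC noBad; apply/ltnW/indG => x y xU yU; apply/negP => xy.
    pose h := [ffun b : bool => if b then x else y].
    have [lt|ge] := ltnP #|common_nbhd (@adj G) C h| q.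
      have /noBad/negP[] : h \in Bad by rewrite inE lt !ffunE xy.
      by apply/forallP => -[]; rewrite ffunE.
    suff /indG : independent (common_nbhd (@adj G) C h) by rewrite ltnNge ge.
    move=> c d; rewrite !inE => /andP[_ /forallP cN] /andP[_ /forallP dN].
    have := K4_free_codegree K4 xy; apply; rewrite inE.
      by have := cN true; have := cN false; rewrite !ffunE => -> ->.
    by have := dN true; have := dN false; rewrite !ffunE => -> ->.
have BadG : #|Bad| <= #|G| * #|G|.
  by apply: leq_trans (max_card _) _; rewrite card_ffun card_bool.
have qB : q * B * B ^ (2 * w) = B ^ (w * w).
  by rewrite -expnSr -expnD; congr (_ ^ _); lia.
(* This dictates the tuple length [4 * w]: [B * q] is at most [#|C| / B ^ (2 * w)], and the
   [4 * w]-th power of that gain, [B ^ (8 * w ^ 2)], beats twice the number [#|G| ^ 2] of pairs. *)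
have small : 2 * (B ^ (4 * w) * (#|Bad| * q ^ (4 * w))) <= #|C| ^ (4 * w).
  apply: leq_trans (leq_expn2r (4 * w) Cge); rewrite -qB !expnMn.
  rewrite -expnM (_ : 2 * w * (4 * w) = 4 * (w * w) + 4 * (w * w)); last by lia.
  have GG : 2 * (#|G| * #|G|) <= B ^ (4 * (w * w) + 4 * (w * w)).
    apply: (@leq_trans (2 * ((2 * B) ^ (2 * (w * w)) * (2 * B) ^ (2 * (w * w))))).
      by rewrite leq_mul2l leq_mul.
    rewrite -expnD addnn -mul2n mulnA expnD.
    rewrite expnMn mulnA leq_mul2r; apply/orP; right.
    rewrite -expnS; apply: (@leq_trans (4 ^ (4 * (w * w)))); last exact: leq_expn2r.
    by rewrite (_ : 4 = 2 ^ 2) // -expnM leq_exp2l //; lia.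
  move: GG BadG (leq_mul (leqnn (B ^ (4 * w) * q ^ (4 * w))) GG).
  by move: (B ^ (4 * w)) (q ^ (4 * w)) (B ^ (4 * (w * w) + _)) => a b c _ ? ?; nia.
have C0 : 0 < #|C| ^ (4 * w) by rewrite expn_gt0 (leq_trans _ Cge) // expn_gt0; lia.
have Xle : #|X| <= 2 * (B ^ (4 * w) * q).
  by rewrite -(leq_pmul2r C0); move: drc small; clear; nia.
apply: leq_trans Gge; apply: (leq_trans (leq_mul Xle (leqnn _))).
apply: (@leq_trans (B * (B ^ (4 * w) * q) * B ^ (w * w - 2 * w))).
  by rewrite !leq_mul2r (leq_trans _ B4) ?orbT.
by rewrite -!expnD -expnS -expnD leq_exp2l; lia.
Qed.

(** With [D = B ^ (w * w - 2 * w)], this length [M] satisfies [D ^ (w * w + 1) * B = B ^ M], so that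
    a random sample contains on average at most [2 ^ M / B] rich [M]-tuples. *)
Definition rich_length w := (w * w - 2 * w) * (w * w + 1) + 1.

(** A random [q]-tuple avoids, with positive probability, rich [M]-tuples ([A1]), copies of the
    pattern in which all the relevant common neighbourhoods are small ([A2]), and repetitions
    ([A3]). *)
Lemma exists_sparse_sample (G : sgraph) (w B : nat) (JR JY : finType)
    (nu : JY -> 'I_(rich_length w) -> JR) :
  3 <= w -> 2 ^ (rich_length w + 2 * (w * w) + 2) <= B ->
  is_free (complete 4) G ->
  (forall I : {set G}, independent I -> #|I| < B ^ (w * w - 2 * w - 1)) ->
  B ^ (2 * (w * w)) <= #|G| <= (2 * B) ^ (2 * (w * w)) ->
  (forall y, injective (nu y)) -> 0 < #|JY| -> w * w * #|JR| <= #|JY| ->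
  exists2 S : {set G}, #|S| = B ^ (w * w - 2 * w - 1) &
    forall f : JR + JY -> G, injective f -> (forall j, f j \in S) ->
      ~ forall y i, adj (f (inl (nu y i))) (f (inr y)).
Proof.
move=> w3 hB K4 indG Gbd nuI JY0 JRJY; have [Gge Gle] := andP Gbd.
set M := rich_length w in nu hB nuI *; set W := w * w in hB indG Gge Gle Gbd JRJY *.
set q := B ^ _ in indG *; pose P := B ^ W; pose D := B ^ (W - 2 * w).
have WW : 3 * w <= W by rewrite leq_mul2r w3 orbT.
have B4 : 4 <= B by apply: leq_trans hB; rewrite (@leq_exp2l 2 2) //; lia.
have B0 : 0 < B by lia.
have qB : q * B = D by rewrite -expnSr; congr (_ ^ _); lia.
have MB : 4 * 2 ^ M <= B.
  by apply: leq_trans hB; rewrite (_ : 4 = 2 ^ 2) // -expnD leq_exp2l //; lia.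
have few := few_rich_vertices w3 B4 K4 indG Gbd.
have G0 : 0 < #|G| by apply: leq_trans Gge; rewrite expn_gt0 B0.
pose N (h : 'I_M -> G) := common_nbhd (@adj G) [set: G] h.
pose A1 := [set h : {ffun 'I_M -> G} | P <= #|N h|].
have A1few : 4 * #|meeting q A1| <= #|G| ^ q.
  apply: card_meeting; rewrite // card_ord.
  (* One extra power of [B] absorbs the factor [2 ^ (2 * W)] in the upper bound on [#|G|]. *)
  have ltG : #|[set: G]| < P * B ^ (W + 1).
    rewrite cardsT; apply: leq_ltn_trans Gle _.
    rewrite expnMn -expnD (_ : W + (W + 1) = (2 * W).+1); last by lia.
    rewrite expnS ltn_mul2r expn_gt0 B0 /=; apply: leq_trans hB.
    by rewrite ltn_exp2l //; lia.
  have D0 : 0 < D by rewrite expn_gt0 B0.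
  have rich : #|A1| * D ^ M <= 2 ^ M * #|G| ^ M * D ^ (W + 1).
    exact: card_rich_tuples few B0 D0 M _ _ ltG.
  have DB : D ^ (W + 1) * B = B ^ M by rewrite -expnM -expnSr -addn1.
  have BM : 0 < B ^ M by rewrite expn_gt0 B0.
  rewrite -(leq_pmul2r BM).
  have -> : 4 * (q ^ M * #|A1|) * B ^ M = 4 * (#|A1| * D ^ M).
    by rewrite -qB expnMn; lia.
  apply: leq_trans (leq_mul (leqnn 4) rich) _; rewrite -DB.
  by move: (leq_mul MB (leqnn (#|G| ^ M * D ^ (W + 1)))); lia.
(* Large common neighbourhoods are replaced by the empty set, so that [K h j] always has at most [P]
   elements; in a sample that avoids [A1] and [A3] they do not occur for copies of the pattern. *)
pose K (h : {ffun JR -> G}) j :=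
  let C := N (fun i => h (nu j i)) in if #|C| < P then C else finset.set0.
pose A2 := [set f : {ffun JR + JY -> G} |
  [forall j, f (inr j) \in K [ffun i => f (inl i)] j]].
have A2few : 4 * #|meeting q A2| <= #|G| ^ q.
  apply: card_meeting; rewrite // card_sum.
  have KP h j : #|K h j| <= P.
    by rewrite /K; case: ifP => [/ltnW//|_]; rewrite cards0.
  have := card_dependent_pairs KP; rewrite -/A2.
  move: #|A2| (#|JR|) (#|JY|) JY0 JRJY => a r y y0 ry ale.
  (* Each vertex of [JY] gains at least [B ^ 2] from [#|G| / (q * P)]: one factor [B] pays for the
     [q ^ r] placements of [JR], the other for the constant 4. *)
  have qr : q ^ r <= B ^ y.
    by rewrite -expnM leq_exp2l; nia.
  have four : 4 <= B ^ y by apply: leq_trans B4 _; rewrite -[leqLHS]expn1 leq_exp2l; lia.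
  have qP : B ^ y * B ^ y * (q * P) ^ y <= #|G| ^ y.
    rewrite -!expnMn; apply: leq_expn2r; apply: leq_trans Gge.
    by rewrite -mulnA -expnD -!expnS leq_exp2l; lia.
  rewrite !expnD; apply: (leq_trans (leq_mul (leqnn 4) (leq_mul (leqnn _) ale))).
  rewrite expnMn in qP.
  apply: (@leq_trans (#|G| ^ r * (B ^ y * B ^ y * (q ^ y * P ^ y)))); last first.
    by rewrite leq_mul2l qP orbT.
  have := leq_mul four qr; set u := #|G| ^ r; set v := q ^ y; set x := P ^ y.
  move=> le4; have := leq_mul le4 (leqnn (u * v * x)); lia.
pose A3 := [set h : {ffun bool -> G} | h true == h false].
have A3few : 4 * #|meeting q A3| <= #|G| ^ q.
  apply: card_meeting; rewrite // card_bool.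
  have A3le : #|A3| <= #|G|.
    have evI : {in A3 &, injective (fun h : {ffun bool -> G} => h true)}.
      move=> h h'; rewrite !inE => /eqP e1 /eqP e2 e3.
      by apply/ffunP => -[//|]; rewrite -e1 -e2.
    by rewrite -(card_in_imset evI) max_card.
  have : 4 * q ^ 2 <= #|G|.
    apply: leq_trans Gge; rewrite -expnM; apply: leq_trans (leq_mul B4 (leqnn _)) _.
    by rewrite -expnS leq_exp2l; lia.
  by move=> qle; rewrite mulnA -[leqRHS]mulnn leq_mul.
have [g] : exists g, g \notin meeting q A1 :|: meeting q A2 :|: meeting q A3.
  apply/existsP; rewrite -negb_forall; apply/negP => /forallP all_meet.
  have Gq : 0 < #|G| ^ q by rewrite expn_gt0 G0.
  have : #|G| ^ q <= #|meeting q A1| + #|meeting q A2| + #|meeting q A3|.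
    have -> : #|G| ^ q = #|[set: {ffun 'I_q -> G}]| by rewrite cardsT card_ffun card_ord.
    apply: leq_trans (leq_add (leq_of_leqif (leq_card_setU _ _)) (leqnn _)).
    apply: leq_trans (leq_of_leqif (leq_card_setU _ _)).
    by apply/subset_leq_card/fintype.subsetP => g _; apply: all_meet.
  by move: Gq A1few A2few A3few; clear; lia.
rewrite !finset.in_setU !negb_or => /andP[/andP[g1 g2] g3].
have gI : injective g.
  move=> i i' gii'; apply/eqP; apply/negPn/negP => ii'.
  case/negP: g3; rewrite inE; apply/existsP; exists [ffun b : bool => if b then i else i'].
  rewrite inE !ffunE gii' eqxx andbT; apply/injectiveP => b b'; rewrite !ffunE.
  by case: b b' => -[] // ii; rewrite ii eqxx in ii'.
exists [set g i | i : 'I_q]; first by rewrite card_imset // card_ord.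
move=> f fI fS fadj.
have subI y : injective (fun i => f (inl (nu y i))).
  by move=> i i' /fI[/nuI].
have f1 y : #|N (fun i => f (inl (nu y i)))| < P.
  have := meetingN g1 (subI y) (fun j => fS _); rewrite inE -ltnNge.
  by rewrite /N (@eq_common_nbhd _ _ _ _ _ (fun i => f (inl (nu y i)))) // => i; rewrite ffunE.
have /negP[] := meetingN g2 fI fS.
rewrite inE; apply/forallP => y; rewrite ffunE /K.
rewrite /N (@eq_common_nbhd _ _ _ _ _ (fun i => f (inl (nu y i)))); last first.
  by move=> i; rewrite !ffunE.
by rewrite f1 !inE /=; apply/forallP => i; apply: fadj.
Qed.

(** For positive [t], the negation is [(t - 1)]-degeneracy. *)
Definition has_core (F : sgraph) (t : nat) : Prop :=
  exists2 Z : {set F}, 0 < #|Z| &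
    forall z, z \in Z -> t <= #|[set x in Z | adj z x]|.

(* [R] is a maximal set subject to [A * #|R| <= Phi R]; then each vertex outside
   of [R] has fewer than [A] neighbours [y] with fewer than [M] neighbours in
   [R], so double counting shows that there are few such [y]. *)
Lemma small_dominating_set (F : sgraph) (M L : nat) :
  0 < M -> 0 < L -> has_core F (M + 16 * (M * L)) ->
  exists R Y : {set F}, [/\ 0 < #|Y|, L * #|R| <= #|Y|,
    forall y, y \in Y -> y \notin R &
    forall y, y \in Y -> M <= #|[set x in R | adj y x]|].
Proof.
move=> M0 L0 [Z Z0 degZ]; pose A := 4 * (M * L).
have A0 : 0 < A by rewrite !muln_gt0 M0 L0.
pose deg (R : {set F}) y := #|[set x in R | adj y x]|.
(* Capping degrees at [M] keeps [Phi] at most [#|Z| * M], which bounds [#|R|] by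
   [#|Z| / (4 * L)]. *)
pose Phi (R : {set F}) := \sum_(y in Z) minn M (deg R y).
pose ok (R : {set F}) := (R \subset Z) && (A * #|R| <= Phi R).
have ok0 : ok finset.set0 by rewrite /ok finset.sub0set cards0 muln0.
have [R /andP[RZ RPhi] Rmax] := @arg_maxnP _ finset.set0 ok (fun R => #|R|) ok0.
pose Act := [set y in Z | deg R y < M].
have addx x : x \in Z :\: R -> #|[set y in Act | adj x y]| <= A.
  rewrite finset.in_setD => /andP[xR xZ]; rewrite leqNgt; apply/negP => ltA.
  have cardxR : #|x |: R| = #|R|.+1 by rewrite cardsU1 xR.
  suff /Rmax : ok (x |: R) by rewrite /= cardxR ltnn.
  rewrite /ok finset.subUset finset.sub1set xZ RZ cardxR mulnS addnC /=.
  apply: leq_trans (leq_add RPhi (ltnW ltA)) _.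
  rewrite -sum1_card big_mkcond /Phi [X in _ + X](_ : _ =
    \sum_(y in Z) (y \in [set y in Act | adj x y])); last first.
    by rewrite [RHS]big_mkcond; apply: eq_bigr => y _; rewrite !inE; do 3!case: ifP => //=.
  rewrite -big_split; apply: leq_sum => y yZ /=; rewrite !inE yZ /=.
  have degS : deg (x |: R) y = adj y x + deg R y.
    rewrite /deg; case: (boolP (adj y x)) => yx.
      rewrite (_ : [set _ in _ | _] = x |: [set z in R | adj y z]).
        by rewrite cardsU1 inE (negbTE xR).
      by apply/setP => z; rewrite !inE; case: eqVneq => [->|].
    apply: eq_card => z; rewrite !inE; case: eqVneq => [->|//].
    by rewrite (negbTE yx) !andbF.
  by rewrite degS (adj_sym x y); case: (adj y x) => /=; lia.
(* The assumed minimum degree is [M + 4 * A], and [y] loses fewer than [M] neighbours to [R]. *)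
have Act_deg y : y \in Act -> 4 * A <= #|[set x in Z :\: R | adj y x]|.
  rewrite inE => /andP[yZ ltM]; have := degZ y yZ.
  have : #|[set x in Z | adj y x]| <= deg R y + #|[set x in Z :\: R | adj y x]|.
    apply: leq_trans (leq_of_leqif (leq_card_setU _ _)).
    apply/subset_leq_card/fintype.subsetP => x; rewrite !inE => /andP[-> ->].
    by case: (x \in R).
  by move: ltM; rewrite /A; lia.
have count : #|Act| * (4 * A) <= #|Z| * A.
  apply: (@leq_trans (\sum_(y in Act) #|[set x in Z :\: R | adj y x]|)).
    by rewrite -sum_nat_const; apply: leq_sum.
  under eq_bigr do rewrite -sum1_card.
  rewrite (exchange_big_dep (mem (Z :\: R))) /=; last first.
    by move=> y x _; rewrite inE => /andP[].
  apply: (@leq_trans (\sum_(x in Z :\: R) A)).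
    apply: leq_sum => x xZR; apply: leq_trans (addx x xZR).
    rewrite -sum1_card; apply/eq_leq/eq_bigl => y.
    by rewrite !inE adj_sym; move: xZR; rewrite inE => ->.
  by rewrite sum_nat_const leq_mul2r subset_leq_card ?orbT // finset.subsetDl.
have PhiM : Phi R <= #|Z| * M.
  by rewrite -sum_nat_const; apply: leq_sum => y _; apply: geq_minl.
have R_small : 4 * (L * #|R|) <= #|Z|.
  rewrite -(leq_pmul2r M0); apply: leq_trans PhiM; apply: leq_trans RPhi.
  by rewrite /A; lia.
have Act_small : 4 * #|Act| <= #|Z| by rewrite -(leq_pmul2r A0); lia.
exists R, (Z :\: (Act :|: R)).
have cardY : #|Z| <= #|Z :\: (Act :|: R)| + (#|Act| + #|R|).
  rewrite -(cardsID (Act :|: R) Z) addnC leq_add2l.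
  apply: leq_trans (leq_of_leqif (leq_card_setU _ _)).
  by apply/subset_leq_card/finset.subsetIr.
have R4 : 4 * #|R| <= #|Z|.
  by apply: leq_trans R_small; rewrite leq_mul2l leq_pmull.
split.
- lia.
- lia.
- by move=> y; rewrite !inE negb_or => /andP[/andP[]].
- move=> y; rewrite !inE negb_or => /andP[/andP[yA yR] yZ].
  by move: yA; rewrite yZ /= -leqNgt.
Qed.

(** A large independent set works at once, since the core gives [F] an edge. Otherwise the sparse
    sample applies to the sets [R] and [Y] found in the core. *)
Lemma exists_free_sample (F G : sgraph) (w B : nat) :
  3 <= w -> 2 ^ (rich_length w + 2 * (w * w) + 2) <= B ->
  has_core F (rich_length w + 16 * (rich_length w * (w * w))) ->
  is_free (complete 4) G ->
  B ^ (2 * (w * w)) <= #|G| <= (2 * B) ^ (2 * (w * w)) ->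
  exists S : {set G}, #|S| = B ^ (w * w - 2 * w - 1) /\ is_free F (Defs.induced S).
Proof.
move=> w3 hB coreF K4 Gbd; set q := B ^ _.
have M0 : 0 < rich_length w by rewrite /rich_length addn1.
have [|R [Y [Y0 RY YR Ydeg]]] := small_dominating_set M0 _ coreF.
  by rewrite muln_gt0; lia.
have [[I indI qI]|noI] := pselect (exists2 I : {set G}, independent I & q <= #|I|).
  have [s [s_uniq s_size sI]] := card_geqP qI.
  exists [set x in s]; split; first by rewrite cardsE (card_uniqP s_uniq).
  move=> [f [_ fadj]].
  have /card_gt0P[y yY] := Y0.
  have /card_gt0P[x] := leq_trans M0 (Ydeg y yY); rewrite inE => /andP[_ yx].
  have fI z : val (f z) \in I by apply: sI; have := valP (f z); rewrite inE.
  by have := indI _ _ (fI y) (fI x); rewrite [adj _ _](fadj _ _ yx).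
pose JR : finType := {x : F | x \in R}; pose JY : finType := {y : F | y \in Y}.
have cardJR : #|JR| = #|R| by rewrite card_sig; apply: eq_card.
have cardJY : #|JY| = #|Y| by rewrite card_sig; apply: eq_card.
have nu_ex (y : JY) : exists f : {ffun 'I_(rich_length w) -> JR},
    injectiveb f && [forall i, adj (val (f i)) (val y)].
  have le := Ydeg (val y) (valP y).
  pose v i := enum_val (widen_ord le i).
  have vP i : v i \in [set x in R | adj (val y) x] by apply: enum_valP.
  have vR i : v i \in R by have := vP i; rewrite inE => /andP[].
  exists [ffun i => exist _ (v i) (vR i) : JR]; apply/andP; split.
    apply/injectiveP => i j; rewrite !ffunE => -[/enum_val_inj /(congr1 val)] /=.
    exact: val_inj.
  by apply/forallP => i; rewrite ffunE /= adj_sym; have := vP i; rewrite inE => /andP[].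
pose nu y : 'I_(rich_length w) -> JR := xchoose (nu_ex y).
have nuP y := xchooseP (nu_ex y).
have [||||S cardS S_sparse] := @exists_sparse_sample G w B JR JY nu w3 hB K4 _ Gbd.
- by move=> I indI; rewrite ltnNge; apply/negP => leI; apply: noI; exists I.
- by move=> y; have /andP[/injectiveP] := nuP y.
- by rewrite cardJY.
- by rewrite cardJR cardJY.
exists S; split=> // -[f [fI fadj]].
pose phi (j : JR + JY) : G := val (f (match j with inl x => val x | inr y => val y end)).
apply: (S_sparse phi).
- move=> [x|y] [x'|y'] /val_inj/fI.
  + by move/val_inj->.
  + by move=> xy; have /negP[] := YR _ (valP y'); rewrite -xy; apply: (valP x).
  + by move=> xy; have /negP[] := YR _ (valP y); rewrite xy; apply: (valP x').
  + by move/val_inj->.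
- by move=> j; apply: (valP (f _)).
- by move=> y i; have /andP[_ /forallP/(_ i)/fadj] := nuP y.
Qed.

End LocallySparseSets.

(** * Embedding degenerate bipartite graphs into dense graphs *)

Section DegenerateBipartite.
Local Open Scope nat_scope.
Local Open Scope set_scope.

Lemma core_free_embedding (F G : sgraph) (r : nat) (U : bool -> {set G}) :
  bipartite F -> ~ has_core F r -> 0 < #|U true| ->
  (forall b (h : {ffun 'I_r -> G}), (forall i, h i \in U b) ->
     #|F| <= #|common_nbhd (@adj G) (U (~~ b)) h|) ->
  contains G F.
Proof.
move=> [A bipA] noCore /card_gt0P[u uU] rich.
pose side x := U (x \in A).
suff emb n : forall Z : {set F}, #|Z| = n -> exists f : F -> G,
    [/\ forall x, x \in Z -> f x \in side x, {in Z &, injective f} &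
        {in Z &, forall x y, adj x y -> adj (f x) (f y)}].
  have [f [_ fI fadj]] := emb _ [set: F] erefl.
  by exists f; split=> [x y|x y]; [apply: fI | apply: fadj]; rewrite inE.
elim: n => [|n IH] Z cardZ.
  by exists (fun=> u); split=> x; rewrite (cards0_eq cardZ) inE.
have [z zZ degz] : exists2 z, z \in Z & #|[set x in Z | adj z x]| < r.
  apply: contrapT => no; apply: noCore; exists Z; first by rewrite cardZ.
  by move=> z zZ; rewrite leqNgt; apply/negP => lt; apply: no; exists z.
have cardZz : #|Z :\ z| = n by move: cardZ; rewrite (cardsD1 z) zZ => -[].
have [f [fside fI fadj]] := IH _ cardZz.
have F0 : 0 < #|F| by apply/card_gt0P; exists z.
(* [d] pads the list of fewer than [r] images to an [r]-tuple. Only [U true] is known to be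
   nonempty, so for the other side [d] comes from [rich]. *)
have [d dU] : exists d, d \in U (z \notin A).
  case: (z \in A) => /=; last by exists u.
  have := rich true [ffun=> u].
  have u_in (i : 'I_r) : [ffun=> u] i \in U true by rewrite ffunE.
  move=> /(_ u_in) /(leq_trans F0) /card_gt0P[d]; rewrite inE => /andP[dU _].
  by exists d.
set N := [set x in Z | adj z x] in degz.
pose h := [ffun i : 'I_r => nth d (map f (enum N)) i].
have hU i : h i \in U (z \notin A).
  rewrite ffunE; have [lt|ge] := ltnP i (size (map f (enum N))); last by rewrite nth_default.
  have /mapP[x] := mem_nth d lt; rewrite mem_enum inE => /andP[xZ zx ->].
  have := fside x; rewrite /side !inE xZ andbT.
  have -> : x \in A = (z \notin A) by have := bipA _ _ zx; case: (z \in A) (x \in A) => -[].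
  by apply; apply/eqP => xz; rewrite xz adj_irr in zx.
have /subsetPn[c] : ~~ (common_nbhd (@adj G) (U (z \in A)) h \subset f @: (Z :\ z)).
  apply/negP => /subset_leq_card; rewrite leqNgt => /negP[].
  have := rich _ h hU; rewrite negbK; apply: leq_trans.
  apply: leq_ltn_trans (leq_imset_card _ _) _; rewrite cardZz -cardZ; exact: max_card.
rewrite inE => /andP[cU /forallP hc] cf.
exists (fun x => if x == z then c else f x).
have Zz x : x \in Z -> x != z -> x \in Z :\ z by rewrite !inE => -> ->.
have zadj x : x \in Z -> adj z x -> adj c (f x).
  move=> xZ zx; have xN : x \in enum N by rewrite mem_enum inE xZ.
  have lt : index x (enum N) < r.
    by apply: leq_trans degz; rewrite cardE ltnS ltnW // index_mem.
  have := hc (Ordinal lt); rewrite ffunE /= (nth_map x) ?index_mem // nth_index //.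
  by rewrite adj_sym.
split.
- by move=> x xZ; case: eqVneq => [->//|xz]; apply: fside; apply: Zz.
- move=> x y xZ yZ; case: (eqVneq x z) => [->|xz]; case: (eqVneq y z) => [->//|yz].
  + by move=> cfy; rewrite cfy imset_f ?Zz in cf.
  + by move=> cfx; rewrite -cfx imset_f ?Zz in cf.
  + by apply: fI; apply: Zz.
- move=> x y xZ yZ; case: (eqVneq x z) => [->|xz]; case: (eqVneq y z) => [->|yz].
  + by rewrite adj_irr.
  + exact: zadj.
  + by rewrite adj_sym => /(zadj _ xZ); rewrite adj_sym.
  + by apply: fadj; apply: Zz.
Qed.

Lemma num_edges_le_sum_deg (G : sgraph) :
  num_edges G <= \sum_(x : G) #|[set y | adj x y]|.
Proof.
pose E := [set p : G * G | adj p.1 p.2].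
apply: (@leq_trans #|E|).
  apply: leq_trans (leq_imset_card (fun p => [set p.1; p.2]) E).
  apply/subset_leq_card/fintype.subsetP => a; rewrite inE.
  move=> /existsP[x /existsP[y /andP[xy /eqP->]]].
  by apply/imsetP; exists (x, y); rewrite ?inE.
rewrite -sum1_card; under [leqRHS]eq_bigr do rewrite -sum1_card.
rewrite pair_big_dep /= eq_leq //; apply: eq_bigl => -[x y] /=.
by rewrite !inE.
Qed.

(** Dependent random choice yields [U1] all of whose [3 * r]-tuples have [s] common neighbours. With
    [T] a suitable [2 * r]-tuple in [U1], [U2] is its common neighbourhood: an [r]-tuple of [U1]
    joined to [T] then has [s] common neighbours in [U2]. *)
Lemma exists_rich_pair (G : sgraph) (B r s : nat) :
  0 < r -> 2 ^ (3 * r + 3) * s < B -> 2 * (2 * s) ^ (3 * r + 1) <= B ->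
  #|G| = B ^ (6 * r + 6) -> #|G| ^ 2 <= num_edges G * B ->
  exists2 U : bool -> {set G}, 0 < #|U true| &
  forall b (h : {ffun 'I_r -> G}), (forall i, h i \in U b) ->
     s <= #|common_nbhd (@adj G) (U (~~ b)) h|.
Proof.
move=> r0 B1 B2 cardG dense; have B0 : 0 < B by apply: leq_ltn_trans B1.
set m := #|G| in cardG dense; have m0 : 0 < m by rewrite cardG expn_gt0 B0.
pose X := [set x : G | m <= 2 * B * #|[set y | adj x y]|].
have X_large : m <= 2 * B * #|X|.
  have := leq_mul (num_edges_le_sum_deg G) (leqnn (2 * B)).
  rewrite big_distrl (bigID (mem X)) /= => le1.
  have le2 : \sum_(x in X) #|[set y | adj x y]| * (2 * B) <= #|X| * (m * (2 * B)).
    rewrite -sum_nat_const; apply: leq_sum => x _.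
    by rewrite leq_mul2r max_card orbT.
  have le3 : \sum_(x | x \notin X) #|[set y | adj x y]| * (2 * B) <= m * m.
    apply: (@leq_trans (\sum_(x : G) m)); last by rewrite sum_nat_const.
    rewrite big_mkcond; apply: leq_sum => x _; rewrite !inE; case: ifP => //.
    by rewrite -ltnNge mulnC => /ltnW.
  have le4 := leq_trans le1 (leq_add le2 le3).
  rewrite -(leq_pmul2l m0); move: le4 dense; rewrite -mulnn; lia.
pose Bad := [set h : {ffun 'I_r + 'I_(2 * r) -> G} |
  #|common_nbhd (@adj G) [set: G] h| < s].
(* [z] is [s] times the square root of [m], as the choice of [T] requires. The exponent [tau] leaves
   a spare factor [m] over the at most [m ^ (3 * r)] bad tuples. *)
pose z := B ^ (3 * r + 3) * s; pose tau := 3 * r + 1.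
have [g [noBad z_lt]] : exists g : {ffun 'I_tau -> G},
    (forall h, h \in Bad -> ~~ [forall j, h j \in common_nbhd (@adj G) X g]) /\
    z < #|common_nbhd (@adj G) X g|.
  apply: contrapT => no.
  have drc : #|X| * m ^ tau <= (2 * B) ^ tau * (z * m ^ tau + #|X| * (#|Bad| * s ^ tau)).
    have := @dependent_random_choice G (@adj G) _ 'I_tau X [set: G] Bad (2 * B) z s.
    rewrite card_ord cardsT; apply; first exact: adj_sym.
    - by move=> x; rewrite inE (eq_card (B := [set y | adj x y])) // => y; rewrite !inE.
    - by move=> h; rewrite inE => /ltnW.
    - by move=> g _ gBad; rewrite leqNgt; apply/negP => lt; apply: no; exists g.
  have BadG : #|Bad| <= m ^ (3 * r).
    apply: leq_trans (max_card _) _; rewrite card_ffun card_sum !card_ord.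
    by rewrite leq_pexp2l //; lia.
  have few : 2 * ((2 * B) ^ tau * (#|Bad| * s ^ tau)) <= m ^ tau.
    rewrite [m ^ tau]expnD expn1.
    have step : 2 * ((2 * B) ^ tau * s ^ tau) <= m.
      rewrite -expnMn (_ : 2 * B * s = 2 * s * B); last by lia.
      rewrite expnMn mulnA; apply: leq_trans (leq_mul B2 (leqnn _)) _.
      by rewrite -expnS cardG leq_pexp2l // /tau; lia.
    by move: (leq_mul BadG step); lia.
  have mt : 0 < m ^ tau by rewrite expn_gt0 m0.
  have X_small : #|X| <= 2 * ((2 * B) ^ tau * z).
    by rewrite -(leq_pmul2r mt); move: drc few; clear; nia.
  have := leq_trans X_large (leq_mul (leqnn (2 * B)) X_small).
  rewrite leqNgt => /negP[]; rewrite cardG.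
  have -> : 2 * B * (2 * ((2 * B) ^ tau * z)) = 2 ^ (3 * r + 3) * s * B ^ (6 * r + 5).
    have -> : 2 ^ (3 * r + 3) = 2 * (2 * 2 ^ tau).
      by rewrite -!expnS; congr (_ ^ _); rewrite /tau; lia.
    have -> : B ^ (6 * r + 5) = B * B ^ tau * B ^ (3 * r + 3).
      by rewrite -expnS -expnD; congr (_ ^ _); rewrite /tau; lia.
    by rewrite expnMn /z; lia.
  by rewrite (_ : 6 * r + 6 = (6 * r + 5).+1) ?expnS ?ltn_mul2r ?expn_gt0 ?B0 //; lia.
set U1 := common_nbhd (@adj G) X g in noBad z_lt.
have U1rich (h : {ffun 'I_r + 'I_(2 * r) -> G}) : (forall j, h j \in U1) ->
    s <= #|common_nbhd (@adj G) [set: G] h|.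
  move=> hU; rewrite leqNgt; apply/negP => lt.
  have /noBad/negP[] : h \in Bad by rewrite inE.
  exact/forallP.
pose poor := [set h : {ffun 'I_r -> G} | #|common_nbhd (@adj G) U1 h| < s].
(* An [r]-tuple [h] of [U2] has [T] inside its neighbourhood in [U1]. A poor [h] admits at most
   [s ^ (2 * r)] such [T]; over all [h] this is fewer than [#|U1| ^ (2 * r)] because
   [m * s ^ 2 <= z ^ 2]. *)
have [T TU1 Tgood] : exists2 T : {ffun 'I_(2 * r) -> G}, T \in ffun_on (mem U1) &
    forall h, h \in poor -> T \notin ffun_on (mem (common_nbhd (@adj G) U1 h)).
  apply: contrapT => no.
  have : #|ffun_on_mem 'I_(2 * r) (mem U1)| <=
      \sum_(h in poor) #|ffun_on_mem 'I_(2 * r) (mem (common_nbhd (@adj G) U1 h))|.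
    apply: card_le_sum_cover => T TU1; apply: contrapT => noh; apply: no.
    by exists T => // h hp; apply/negP => hT; apply: noh; exists h.
  rewrite card_ffun_on card_ord leqNgt => /negP[].
  apply: (@leq_ltn_trans (m ^ r * s ^ (2 * r))).
    apply: (@leq_trans (\sum_(h in poor) s ^ (2 * r))).
      apply: leq_sum => h; rewrite inE card_ffun_on card_ord => /ltnW; exact: leq_expn2r.
    rewrite sum_nat_const leq_mul2r; apply/orP; right.
    by apply: leq_trans (max_card _) _; rewrite card_ffun card_ord.
  rewrite !expnM -expnMn ltn_exp2r //.
  apply: (@leq_ltn_trans (z ^ 2)); last by rewrite ltn_exp2r.
  by rewrite /z expnMn cardG -expnM leq_mul2r leq_pexp2l ?orbT //; lia.
pose U2 := common_nbhd (@adj G) [set: G] T.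
move/ffun_onP: (TU1) => TU.
exists (fun b => if b then U1 else U2); first by apply: leq_ltn_trans z_lt.
move=> [] h hU /=.
  pose hT : {ffun 'I_r + 'I_(2 * r) -> G} :=
    [ffun j => match j with inl i => h i | inr i => T i end].
  apply: leq_trans (U1rich hT _) _.
    by move=> [i|i]; rewrite ffunE // TU.
  apply/subset_leq_card/fintype.subsetP => c; rewrite !inE /= => /forallP hTc.
  apply/andP; split; apply/forallP => i.
    by have := hTc (inr i); rewrite ffunE.
  by have := hTc (inl i); rewrite ffunE.
rewrite leqNgt; apply/negP => lt.
have /Tgood/negP[] : h \in poor by rewrite inE.
apply/ffun_onP => i; rewrite inE TU; apply/forallP => j.
by have := hU j; rewrite inE => /andP[_ /forallP/(_ i)]; rewrite adj_sym.
Qed.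

End DegenerateBipartite.

(** * Bounds on [turan] and [fFH] in powers of a base *)

Section NatBounds.
Local Open Scope nat_scope.

Lemma turan_core_free (F : sgraph) (B r : nat) :
  bipartite F -> 0 < r -> ~ has_core F r ->
  2 ^ (3 * r + 3) * #|F| < B -> 2 * (2 * #|F|) ^ (3 * r + 1) <= B ->
  turan (B ^ (6 * r + 6)) F * B <= (B ^ (6 * r + 6)) ^ 2.
Proof.
move=> bipF r0 noCore B1 B2; have B0 : 0 < B by apply: leq_ltn_trans B1.
rewrite -leq_divRL //; apply/bigmax_leqP => k /asboolP[G [cardG [Gfree Gk]]].
rewrite leq_divRL // leqNgt; apply/negP => dense; apply: Gfree.
have [|U U0 Urich] := exists_rich_pair r0 B1 B2 cardG; first by rewrite cardG Gk ltnW.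
exact: core_free_embedding bipF noCore U0 Urich.
Qed.

Lemma fFH_K4_lower (F : sgraph) (w B n : nat) :
  3 <= w -> 2 ^ (rich_length w + 2 * (w * w) + 2) <= B ->
  has_core F (rich_length w + 16 * (rich_length w * (w * w))) ->
  B ^ (2 * (w * w)) <= n <= (2 * B) ^ (2 * (w * w)) ->
  B ^ (w * w - 2 * w - 1) <= fFH F (complete 4) n.
Proof.
move=> w3 hB coreF nB.
have qn : B ^ (w * w - 2 * w - 1) < n.+1.
  rewrite ltnS; case/andP: nB => + _; apply: leq_trans.
  by rewrite leq_pexp2l ?(leq_trans _ hB) ?expn_gt0 //; lia.
apply: (leq_bigmax_cond (Ordinal qn)); apply/asboolP => G cardG K4.
by apply: (exists_free_sample w3 hB coreF K4); rewrite cardG.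
Qed.

(** [B] is the integer [L]-th root of [n], and [B.+1 <= 2 * B]. *)
Lemma nat_root_bounds (B0 L n : nat) : 0 < L -> (2 * B0) ^ L < n ->
  exists2 B, B0 <= B & B ^ L <= n <= (2 * B) ^ L.
Proof.
move=> L0 nB0.
have ex : exists B, B ^ L <= n by exists 0; rewrite exp0n.
have bd B : B ^ L <= n -> B <= n.
  apply: leq_trans; case: L L0 {nB0 ex} => // L _; rewrite expnS.
  by case: B => // B; rewrite leq_pmulr ?expn_gt0.
have [B Bn Bmax] := ex_maxnP ex bd.
have ltB : n < B.+1 ^ L by rewrite ltnNge; apply/negP => /Bmax; rewrite ltnn.
have B1 : 0 < B.
  have := Bmax 1; rewrite exp1n; apply; exact: leq_ltn_trans nB0.
have le2 : B.+1 ^ L <= (2 * B) ^ L by rewrite leq_exp2r // mul2n -addnn -addn1 leq_add2l.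
exists B; last by rewrite Bn (leq_trans (ltnW ltB)).
have := ltn_trans nB0 ltB; rewrite ltn_exp2r //; lia.
Qed.

End NatBounds.

(** * Choice of constants and passage to real exponents *)

Local Open Scope classical_set_scope.
Local Open Scope ring_scope.

Theorem corollary1p6 (R : realType) (eps : R) (eps_gt0 : 0 < eps) :
  exists2 delta : R, 0 < delta &
    forall F : sgraph, bipartite F ->
      (fun m : nat => (turan m F)%:R : R)
        \is 'Omega_\oo (fun m : nat => m%:R `^ (2 - delta) : R) ->
      (fun n : nat => (fFH F (complete 4) n)%:R : R)
        \is 'Omega_\oo (fun n : nat => n%:R `^ (2^-1 - eps) : R).
Proof.
(* The exponent reached is [1/2 - (2 * w + 1) / (2 * w ^ 2)]; the loss is at most [eps] once
   [w * eps >= 2]. *)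
pose w := (Num.bound (2 / eps) + 3)%N.
have w3 : (3 <= w)%N by rewrite leq_addl.
have w_eps : 2 <= w%:R * eps.
  rewrite -ler_pdivrMr // natrD; apply: ler_wpDr => //.
  by apply/ltW/archi_boundP; rewrite divr_ge0 // ltW.
clearbody w.
pose t := (rich_length w + 16 * (rich_length w * (w * w)))%N.
have t0 : (0 < t)%N by rewrite /t /rich_length !addn1.
pose L := (6 * t + 6)%N.
have L0 : (0 < L)%N by rewrite /L addn_gt0 orbT.
(* For [m = b ^ (2 * L)] this makes [m ^ delta] equal to [b], whereas the core-free bound with base
   [b ^ 2] gains a factor [b ^ 2] over [m ^ 2]. *)
exists (2 * L)%:R^-1; first by rewrite invr_gt0 ltr0n muln_gt0.
move=> F bipF; rewrite !qualifE => /asboolP[k k0 [N _ turanN]]; apply/asboolP.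
have [coreF|noCore] := pselect (has_core F t).
  pose W := (w * w)%N; pose d := (W - 2 * w - 1)%N.
  pose B0 := (2 ^ (rich_length w + 2 * (w * w) + 2))%N.
  (* The constant pays for the gap between [B] and [2 * B]: [n ^ (d / (2 * W))] is at most
     [(2 * B) ^ d]. *)
  exists (2 ^+ d)^-1; first by rewrite invr_gt0 exprn_gt0.
  exists ((2 * B0) ^ (2 * W)).+1 => // n /= nB0.
  have W0 : (0 < 2 * W)%N by rewrite !muln_gt0; lia.
  have [B B0B nB] := nat_root_bounds W0 nB0.
  have low := fFH_K4_lower w3 B0B coreF nB.
  have n1 : 1 <= n%:R :> R by rewrite ler1n; apply: leq_trans nB0.
  rewrite normr_nat ger0_norm ?powR_ge0 // ler_pdivrMl ?exprn_gt0 //.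
  pose y : R := d%:R / (2 * W)%:R.
  have dW : (d + 2 * w + 1 = W)%N by rewrite /d /W; nia.
  have WR : 0 < W%:R :> R by rewrite ltr0n; lia.
  have exponent : 2^-1 - eps <= y.
    rewrite /y ler_pdivlMr ?ltr0n // natrM.
    have dE : d%:R = W%:R - 2 * w%:R - 1 :> R by rewrite -dW 2!natrD natrM; ring.
    have WE : W%:R = w%:R * w%:R :> R by rewrite /W natrM.
    have w1 : 3 <= w%:R :> R by rewrite (ler_nat _ 3).
    rewrite dE; have := ler_wpM2l (ltW (lt_le_trans (ltr0n R 3) w1)) w_eps.
    rewrite mulrA -WE; lra.
  apply: le_trans (ler_powR n1 exponent) _.
  have y0 : 0 <= y by rewrite divr_ge0.
  have /andP[_ nle] := nB; rewrite -(ler_nat R) in nle.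
  apply: le_trans (ge0_ler_powR y0 _ _ nle) _; rewrite ?nnegrE //.
  rewrite natrX -powR_mulrn // -powRrM /y mulrC divfK ?pnatr_eq0 -?lt0n //.
  rewrite powR_mulrn // natrM exprMn ler_wpM2l ?exprn_ge0 //.
  by rewrite -natrX ler_nat.
exfalso.
pose s := #|F|; pose c1 := (2 ^ (3 * t + 3) * s)%N; pose c2 := (2 * (2 * s) ^ (3 * t + 1))%N.
(* [b] exceeds [1 / k], which makes the two Turán bounds contradictory, as well as [N] and the
   thresholds [c1], [c2]. *)
pose b := (Num.bound k^-1 + (N + (c1 + c2)) + 1)%N.
have b1 : (1 <= b)%N by rewrite leq_addl.
have bb : (b <= b * b)%N by rewrite leq_pmulr.
have kb : 1 < k * b%:R.
  rewrite -ltr_pdivrMl // mulr1; apply: lt_le_trans (archi_boundP _) _.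
    by rewrite invr_ge0 ltW.
  by rewrite ler_nat /b -!addnA leq_addr.
pose m := ((b * b) ^ L)%N.
have up : (turan m F * (b * b) <= m ^ 2)%N.
  apply: turan_core_free => //.
    by apply: leq_trans bb; rewrite -/c1 /b; lia.
  by apply: leq_trans bb; rewrite -/c2 /b; lia.
have mN : (N <= m)%N.
  apply: (@leq_trans b); first by rewrite /b; lia.
  by apply: (leq_trans bb); rewrite -[leqLHS]expn1; apply: leq_pexp2l.
have := turanN m mN; rewrite /= normr_nat ger0_norm ?powR_ge0 //.
set p := m%:R `^ _ => low.
have m0 : 0 < m%:R :> R by rewrite ltr0n expn_gt0 muln_gt0 b1.
have mb : m%:R `^ (2 * L)%:R^-1 = b%:R :> R.
  rewrite /m mulnn -expnM natrX -powR_mulrn // -powRrM divff ?powRr1 //.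
  by rewrite pnatr_eq0 -lt0n muln_gt0.
have pb : p * b%:R = m%:R ^+ 2.
  by rewrite -mb -powRD ?subrK ?powR_mulrn ?ltW // gt_eqF ?implybT.
have p0 : 0 < p by apply: powR_gt0.
move: up; rewrite -(ler_nat R) natrM natrX -pb natrM => up.
have b0 : 0 < b%:R :> R by rewrite ltr0n.
have : k * p * (b%:R * b%:R) <= p * b%:R.
  by apply: le_trans up; rewrite ler_wpM2r // mulr_ge0 ?ltW.
have -> : k * p * (b%:R * b%:R) = (k * b%:R) * (p * b%:R) by ring.
by rewrite ger_pMl ?mulr_gt0 // leNgt kb.
Qed.
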